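(* Let $G=G_0*_HG_1$ be a nondegenerate free product with amalgamation, and let $K_0,K_1$ be as defined below. The following are equivalent: (i) $K_0=K_1=\{e\}$; (ii) for every finite $F\subseteq G\setminus\{e\}$ there exists $g\in G$ with $gFg^{-1}\cap H=\varnothing$; (iii) for every finite $F\subseteq H\setminus\{e\}$ there exists $g\in G$ with $gFg^{-1}\cap H=\varnothing$. Moreover, any one of these equivalent conditions implies that $G$ is a Powers group and has the free semigroup property.
   Context: The amalgam is nondegenerate if $([G_0:H]-1)([G_1:H]-1)\ge 2$. For $j=0,1$ and $k\ge1$ let $T_{j,k}=\{g_0g_1\cdots g_{k-1}: g_i\in G_{i+j \bmod 2}\setminus H\}$, and $T_{j,0}=H$. Let $C_{j,k}=\bigcap_{g\in T_{j,k}}gHg^{-1}$ and $K_j=\bigcap_{k\ge0}C_{j,k}$ for $j=0,1$. A group $G$ is a Powers group if for every finite $F\subseteq G\setminus\{e\}$ and every integer $k\ge1$ there exist a partition $G=D\sqcup E$ and elements $g_1,\dots,g_k\in G$ such that $fD\cap D=\varnothing$ for all $f\in F$ and $g_iE\cap g_jE=\varnothing$ for all distinct $i,j$. $G$ has the free semigroup property if for every finite $F\subseteq G$ there is $g\in G$ such that the subsemigroup generated by $gF$ is free on $gF$. *)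

(* Defs.v *)
From Stdlib Require Import List Arith.
Import ListNotations.
Set Implicit Arguments.

Record grp := Grp {
  carrier :> Type;
  gmul : carrier -> carrier -> carrier;
  gone : carrier;
  ginv : carrier -> carrier;
  gmulA : forall x y z, gmul x (gmul y z) = gmul (gmul x y) z;
  gmul1l : forall x, gmul gone x = x;
  gmul1r : forall x, gmul x gone = x;
  gmulVl : forall x, gmul (ginv x) x = gone;
  gmulVr : forall x, gmul x (ginv x) = gone
}.

Arguments gmul {g}.
Arguments gone {g}.
Arguments ginv {g}.

Definition subgroup {G : grp} (S : G -> Prop) : Prop :=
  S gone /\ (forall x y, S x -> S y -> S (gmul x y)) /\ (forall x, S x -> S (ginv x)).

Definition gprod {G : grp} (l : list G) : G := fold_right gmul gone l.

Definition ghom {G L : grp} (f : G -> L) : Prop :=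
  forall x y, f (gmul x y) = gmul (f x) (f y).

(** A homomorphism defined on a subgroup S (values outside S are irrelevant) *)
Definition ghom_on {G L : grp} (S : G -> Prop) (f : G -> L) : Prop :=
  forall x y, S x -> S y -> f (gmul x y) = gmul (f x) (f y).

(** G is the free product of its subgroups G0 and G1 amalgamated along the
    common subgroup H (H <= G0, H <= G1), via the universal property:
    every pair of homomorphisms f0 : G0 -> L, f1 : G1 -> L agreeing on H
    extends uniquely to a homomorphism G -> L. *)
Definition is_amalgam {G : grp} (G0 G1 H : G -> Prop) : Prop :=
  forall (L : grp) (f0 f1 : G -> L),
    ghom_on G0 f0 -> ghom_on G1 f1 ->
    (forall h, H h -> f0 h = f1 h) ->
    (exists f : G -> L, ghom f /\ (forall x, G0 x -> f x = f0 x)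
                                 /\ (forall x, G1 x -> f x = f1 x))
    /\ (forall f f' : G -> L, ghom f -> ghom f' ->
          (forall x, G0 x -> f x = f' x) -> (forall x, G1 x -> f x = f' x) ->
          forall x, f x = f' x).

Definition index_ge {G : grp} (A H : G -> Prop) (n : nat) : Prop :=
  exists l : list G, length l = n /\ (forall x, In x l -> A x) /\
    forall i j, i < n -> j < n -> i <> j ->
      ~ H (gmul (ginv (nth i l gone)) (nth j l gone)).

(** Nondegeneracy: ([G0:H]-1)([G1:H]-1) >= 2 (indices possibly infinite cardinals),
    i.e. both indices are >= 2 and at least one of them is >= 3. *)
Definition nondegenerate {G : grp} (G0 G1 H : G -> Prop) : Prop :=
  (index_ge G0 H 2 /\ index_ge G1 H 3) \/ (index_ge G0 H 3 /\ index_ge G1 H 2).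

Definition Gsel {G : grp} (G0 G1 : G -> Prop) (j : nat) : G -> Prop :=
  if Nat.even j then G0 else G1.

Fixpoint alt_word {G : grp} (G0 G1 H : G -> Prop) (j : nat) (l : list G) : Prop :=
  match l with
  | [] => True
  | a :: l' => Gsel G0 G1 j a /\ ~ H a /\ alt_word G0 G1 H (S j) l'
  end.

Definition Tset {G : grp} (G0 G1 H : G -> Prop) (j k : nat) (g : G) : Prop :=
  match k with
  | 0 => H g
  | _ => exists l, length l = k /\ alt_word G0 G1 H j l /\ g = gprod l
  end.

Definition Cset {G : grp} (G0 G1 H : G -> Prop) (j k : nat) (x : G) : Prop :=
  forall g, Tset G0 G1 H j k g -> H (gmul (gmul (ginv g) x) g).

Definition Kset {G : grp} (G0 G1 H : G -> Prop) (j : nat) (x : G) : Prop :=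
  forall k, Cset G0 G1 H j k x.

Definition powers_group (G : grp) : Prop :=
  forall (F : list G) (k : nat),
    (forall f, In f F -> f <> gone) -> 1 <= k ->
    exists (D : G -> Prop) (g : nat -> G),
      (* E is the complement of D, so G = D ⊔ E *)
      (forall f, In f F -> forall x, D x -> ~ D (gmul f x)) /\
      (forall i j, 1 <= i <= k -> 1 <= j <= k -> i <> j ->
         forall x y, ~ D x -> ~ D y -> gmul (g i) x <> gmul (g j) y).

(** Free semigroup property: the subsemigroup generated by gF is free on the set gF,
    i.e. two nonempty words over gF with equal products are equal words. *)
Definition free_semigroup_property (G : grp) : Prop :=
  forall F : list G, exists g : G,
    forall u v : list G,
      u <> [] -> v <> [] ->
      (forall a, In a u -> exists f, In f F /\ a = gmul g f) ->
      (forall a, In a v -> exists f, In f F /\ a = gmul g f) ->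
      gprod u = gprod v -> u = v.

(* Main.v *)
(** Call x one-sided of type i if its reduced form starts and ends with a letter of
    G_i; then x is not in H, and if u is reduced and starts with a letter of the other
    factor, u^-1 x u is one-sided of the type of the last letter of u.  When K_0 and K_1
    are trivial, every x <> e becomes one-sided after conjugation by some u starting
    with a prescribed type: elements of H leave H along some word by triviality of the
    K_j, words of even length are treated with a letter of the factor of index at
    least 3, and words of odd length are shortened by cyclic reduction.  Treating
    the elements of a finite set F one after the other, a single u makes all
    of u^-1 F u one-sided of one type i, which gives (ii).  Conversely, if x <> e lies
    in K_j and s is a letter of G_j, each conjugate of the set {x, s^-1 x s} meets H.

    One-sided elements of type i map the complement of the set A_i of elements
    starting with type i into A_i, which yields D = u (G - A_i) for the Powers property.
    For the free semigroup property, make the quotients f^-1 f' (f <> f' in F) one-sided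
    of type i by conjugation by c, and take letters b, b' of the other factor with
    b'^-1 b outside H and a letter a of G_i: then g = c b a b'^-1 c^-1 plays
    ping-pong on c b A_i.

    Reduced words are shown to be nontrivial by van der Waerden's action of G on normal
    forms, which exists by the universal property. *)

Require Import Defs.
From Stdlib Require Import List Arith Bool Lia.
From Stdlib Require Import Classical ClassicalEpsilon FunctionalExtensionality.
From Stdlib Require Import PropExtensionality ProofIrrelevance.
Import ListNotations.

Local Notation "x ** y" := (gmul x y) (at level 40, left associativity).
Local Notation "x ^-1" := (ginv x) (at level 3, left associativity, format "x ^-1").

(** * Groups, permutation groups and subgroups *)

Section Group.
Context {G : grp}.
Implicit Types (x y z : G) (S : G -> Prop).

Lemma mulgA x y z : (x ** y) ** z = x ** (y ** z).
Proof. symmetry; apply gmulA. Qed.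

Lemma mulKg x y : x^-1 ** (x ** y) = y.
Proof. now rewrite gmulA, gmulVl, gmul1l. Qed.

Lemma mulKVg x y : x ** (x^-1 ** y) = y.
Proof. now rewrite gmulA, gmulVr, gmul1l. Qed.

Lemma mulgI x y z : x ** y = x ** z -> y = z.
Proof. intros e; rewrite <- (mulKg x y), e; apply mulKg. Qed.

Lemma invg_uniq x y : x ** y = gone -> y = x^-1.
Proof. intros e; apply (mulgI x); now rewrite e, gmulVr. Qed.

Lemma invgK x : x^-1^-1 = x.
Proof. symmetry; apply invg_uniq, gmulVl. Qed.

Lemma invMg x y : (x ** y)^-1 = y^-1 ** x^-1.
Proof. symmetry; apply invg_uniq; now rewrite mulgA, mulKVg, gmulVr. Qed.

Lemma invg1 : gone^-1 = gone :> G.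
Proof. symmetry; apply invg_uniq, gmul1l. Qed.

Lemma sub1 S : subgroup S -> S gone.
Proof. firstorder. Qed.

Lemma subM S x y : subgroup S -> S x -> S y -> S (x ** y).
Proof. firstorder. Qed.

Lemma subV S x : subgroup S -> S x -> S x^-1.
Proof. firstorder. Qed.

End Group.

Ltac sub := repeat first
  [ assumption
  | lazymatch goal with
    | |- _ (gmul _ _) => apply subM
    | |- _ (ginv _) => apply subV
    | |- _ gone => apply sub1
    end
  | match goal with
    | h : forall b, subgroup _ |- subgroup _ => apply h
    | h : forall b x, ?H x -> ?P b x |- ?P _ _ => apply h
    end ].

Section Subgroups.
Context {G : grp}.
Implicit Types (x y z : G) (S : G -> Prop).

Lemma subV_iff S x : subgroup S -> S x^-1 <-> S x.
Proof.
  intros sS; split; intros h; [rewrite <- (invgK x)|]; now apply subV.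
Qed.

Lemma subMl S x y : subgroup S -> S x -> S (x ** y) <-> S y.
Proof.
  intros sS hx; split; intros h; [|now apply subM].
  rewrite <- (mulKg x y); sub.
Qed.

Lemma subMr S x y : subgroup S -> S y -> S (x ** y) <-> S x.
Proof.
  intros sS hy; rewrite <- (subV_iff S (x ** y)), invMg by assumption.
  rewrite subMl by sub; now apply subV_iff.
Qed.

End Subgroups.

#[local] Hint Rewrite @mulgA @mulKg @mulKVg @invMg @invgK @invg1
  @gmul1l @gmul1r @gmulVl @gmulVr : grp.

Ltac grp := autorewrite with grp.
Ltac grp_eq := grp; reflexivity.

Lemma conjg_neq1 {G : grp} (x u : G) : x <> gone -> u^-1 ** x ** u <> gone.
Proof.
  intros nx e; apply nx.
  replace x with (u ** (u^-1 ** x ** u) ** u^-1) by grp_eq.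
  rewrite e; grp_eq.
Qed.

Section Permutations.
Context (X : Type).

Record perm := Perm {
  fwd : X -> X; bwd : X -> X;
  fwdK : forall x, bwd (fwd x) = x;
  bwdK : forall x, fwd (bwd x) = x }.

Lemma perm_eq (p q : perm) : (forall x, fwd p x = fwd q x) -> p = q.
Proof.
  intros e; assert (e' : forall x, bwd p x = bwd q x).
  { intros x; rewrite <- (bwdK q x) at 1; rewrite <- e; apply fwdK. }
  destruct p as [f f' k k'], q as [g g' l l']; simpl in *.
  apply functional_extensionality in e, e'; subst.
  f_equal; apply proof_irrelevance.
Qed.

Definition perm_one : perm := Perm (fun x => x) (fun x => x)
  (fun _ => eq_refl) (fun _ => eq_refl).

Program Definition perm_mul (p q : perm) : perm :=
  Perm (fun x => fwd p (fwd q x)) (fun x => bwd q (bwd p x)) _ _.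
Next Obligation. now rewrite !fwdK. Qed.
Next Obligation. now rewrite !bwdK. Qed.

Definition perm_inv (p : perm) : perm := Perm (bwd p) (fwd p) (bwdK p) (fwdK p).

Program Definition perm_grp : grp := @Grp perm perm_mul perm_one perm_inv _ _ _ _ _.
Solve Obligations with
  (intros; apply perm_eq; intros; simpl; rewrite ?fwdK, ?bwdK; reflexivity).

End Permutations.

Section SubgroupGroup.
Context {G : grp} (S : G -> Prop) (sS : subgroup S).

Lemma sig_val_inj (x y : sig S) : proj1_sig x = proj1_sig y -> x = y.
Proof.
  destruct x, y; simpl; intros; subst; f_equal; apply proof_irrelevance.
Qed.

Program Definition sub_grp : grp := @Grp (sig S)
  (fun x y => exist S (proj1_sig x ** proj1_sig y) _) (exist S gone _)
  (fun x => exist S (proj1_sig x)^-1 _) _ _ _ _ _.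
Next Obligation. simpl; sub. Qed.
Next Obligation. now apply sub1. Qed.
Next Obligation. simpl; sub. Qed.
Solve Obligations with
  (intros; apply sig_val_inj; simpl; rewrite ?gmulA, ?gmul1l, ?gmul1r,
     ?gmulVl, ?gmulVr; reflexivity).

End SubgroupGroup.

(** * Reduced words and the normal form theorem *)

Section ReducedWords.
Context {G : grp} (P : bool -> G -> Prop) (H : G -> Prop).
Context (sP : forall b, subgroup (P b)) (sH : subgroup H).
Context (HP : forall b h, H h -> P b h).
Implicit Types (a x y z u h g : G) (b c d : bool).

Definition letter b a := P b a /\ ~ H a.

(** The indices are the type of the first letter, the type of the last letter and the length. Only
    the value of the word is kept, so uniqueness of reduced forms is not built in. *)
Inductive red : bool -> bool -> nat -> G -> Prop :=
| red_letter b a : letter b a -> red b b 1 a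
| red_cons b c n a x :
    letter b a -> red (negb b) c n x -> red b c (S n) (a ** x).

Lemma letterV b a : letter b a -> letter b a^-1.
Proof. intros [h1 h2]; split; [now apply subV | now rewrite subV_iff]. Qed.

Lemma letter_mulH b h a : H h -> letter b a -> letter b (h ** a).
Proof.
  intros hh [h1 h2]; split; [sub | now rewrite subMl].
Qed.

Lemma red_cat b c d n m x y :
  red b c n x -> red (negb c) d m y -> red b d (n + m) (x ** y).
Proof.
  induction 1 as [b a la|b c n a x la rx IH]; intros ry; simpl.
  - now constructor.
  - rewrite mulgA; constructor; auto.
Qed.

Lemma red_inv b c n x : red b c n x -> red c b n x^-1.
Proof.
  induction 1 as [b a la|b c n a x la rx IH].
  - constructor; now apply letterV.
  - rewrite invMg, <- Nat.add_1_r; eapply red_cat; [exact IH|].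
    rewrite negb_involutive; constructor; now apply letterV.
Qed.

Lemma red_mulHl b c n h x : H h -> red b c n x -> red b c n (h ** x).
Proof.
  intros hh [b' a la|b' c' n' a x' la rx].
  - constructor; now apply letter_mulH.
  - rewrite <- mulgA; constructor; auto using letter_mulH.
Qed.

Lemma red_mulHr b c n h x : H h -> red b c n x -> red b c n (x ** h).
Proof.
  intros hh r; rewrite <- (invgK (x ** h)), invMg.
  apply red_inv, red_mulHl, red_inv; sub.
Qed.

Lemma red_uncons b c n x : red b c n x ->
  (n = 1 /\ b = c /\ letter b x) \/
  exists m a y, n = S m /\ letter b a /\ red (negb b) c m y /\ x = a ** y.
Proof. intros []; [now left | right; eauto 8]. Qed.

Lemma red_unsnoc b c n x : red b c n x ->
  (n = 1 /\ b = c /\ letter c x) \/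
  exists m a y, n = S m /\ letter c a /\ red b (negb c) m y /\ x = y ** a.
Proof.
  intros r; destruct (red_uncons _ _ _ _ (red_inv _ _ _ _ r))
    as [(->&->&l)|(m&a&y&->&l&ry&e)].
  - left; apply letterV in l; rewrite invgK in l; auto.
  - right; exists m, a^-1, y^-1; split; [reflexivity|].
    split; [now apply letterV|]; split; [now apply red_inv|].
    now rewrite <- (invgK x), e, invMg.
Qed.

Section NormalForm.

(** A chosen representative of the coset [H x]. It need not be [gone] on [H] itself: [join_nf] tests
    membership in [H] before calling it. *)
Definition rep x : G := epsilon (inhabits gone) (fun y => exists h, H h /\ x = h ** y).

Lemma rep_spec x : exists h, H h /\ x = h ** rep x.
Proof.
  apply (epsilon_spec (inhabits gone) (fun y => exists h, H h /\ x = h ** y)).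
  exists x, gone; split; [now apply sub1 | grp_eq].
Qed.

(** Both elements give [epsilon] extensionally equal predicates, hence the same choice. *)
Lemma rep_mulH h x : H h -> rep (h ** x) = rep x.
Proof.
  intros hh; unfold rep; f_equal; apply functional_extensionality; intros y.
  apply propositional_extensionality; split; intros (k&hk&e).
  - exists (h^-1 ** k); split; [sub|].
    now rewrite mulgA, <- e, mulKg.
  - exists (h ** k); split; [now apply subM|]; rewrite e; grp_eq.
Qed.

Lemma rep_coset x : H (x ** (rep x)^-1).
Proof.
  destruct (rep_spec x) as (h&hh&e).
  replace (x ** (rep x)^-1) with h; [assumption|].
  rewrite e at 1; grp_eq.
Qed.

Lemma rep_rep x : rep (rep x) = rep x.
Proof.
  destruct (rep_spec x) as (h&hh&e).
  rewrite e at 2; symmetry; now apply rep_mulH.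
Qed.

Lemma letter_rep b x : letter b x -> letter b (rep x).
Proof.
  intros l; replace (rep x) with ((x ** (rep x)^-1)^-1 ** x) by grp_eq.
  apply letter_mulH; [apply subV, rep_coset; exact sH | exact l].
Qed.

(* The normal form [h t_1 ... t_n] is encoded as [h] together with the list of the
   coset representatives [t_i], each tagged by its type. *)
Definition nform : Type := G * list (bool * G).
Implicit Types (p : nform).

Definition not_start b (w : list (bool * G)) : Prop :=
  match w with [] => True | (c, _) :: _ => c = negb b end.

Fixpoint tail_ok (w : list (bool * G)) : Prop :=
  match w with
  | [] => True
  | (c, t) :: r => letter c t /\ rep t = t /\ not_start c r /\ tail_ok r
  end.

Definition valid (x : nform) : Prop := H (fst x) /\ tail_ok (snd x).

(* Normal forms correspond to [P b] times the tails not starting with type [b];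
   [P b] acts by left translation of the first coordinate. *)
Definition split_nf b (x : nform) : nform :=
  match snd x with
  | (c, t) :: r => if eqb b c then (fst x ** t, r) else x
  | [] => x
  end.

Definition join_nf b (p : nform) : nform :=
  if excluded_middle_informative (H (fst p)) then p
  else (fst p ** (rep (fst p))^-1, (b, rep (fst p)) :: snd p).

Definition split_ok b (p : nform) : Prop :=
  P b (fst p) /\ not_start b (snd p) /\ tail_ok (snd p).

Lemma split_nf_ok b (x : nform) : valid x -> split_ok b (split_nf b x).
Proof.
  destruct x as [h [|[c t] r]]; intros [hh ok]; simpl in *; unfold split_nf; simpl.
  - repeat split; auto.
  - destruct ok as ((pt&nt)&et&nr&ok); destruct (eqb_spec b c) as [<-|ne].
    + repeat split; simpl; auto; sub.
    + repeat split; simpl; auto; now destruct b, c.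
Qed.

Lemma join_nf_valid b p : split_ok b p -> valid (join_nf b p).
Proof.
  destruct p as [g r]; intros (pg&nr&ok); unfold join_nf; simpl in *.
  destruct excluded_middle_informative as [hg|ng]; split; simpl; auto using rep_coset.
  repeat split; auto using rep_rep; now apply (letter_rep b).
Qed.

Lemma split_nfK b (x : nform) : valid x -> join_nf b (split_nf b x) = x.
Proof.
  assert (base : forall h r, H h -> join_nf b (h, r) = (h, r)).
  { intros h r hh; unfold join_nf; simpl.
    now destruct excluded_middle_informative. }
  destruct x as [h [|[c t] r]]; intros [hh ok]; simpl in *; unfold split_nf; simpl; auto.
  destruct (eqb_spec b c) as [<-|ne]; auto.
  destruct ok as ((pt&nt)&et&nr&ok); unfold join_nf; simpl.
  rewrite rep_mulH, et by assumption.
  destruct excluded_middle_informative as [hg|ng].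
  - now rewrite subMl in hg.
  - f_equal; grp_eq.
Qed.

Lemma join_nfK b p : split_ok b p -> split_nf b (join_nf b p) = p.
Proof.
  destruct p as [g r]; intros (pg&nr&ok); unfold join_nf; simpl in *.
  destruct excluded_middle_informative as [hg|ng]; unfold split_nf; simpl.
  - destruct r as [|[c t] r]; auto; simpl in nr; subst; now destruct b.
  - rewrite eqb_reflx; f_equal; grp_eq.
Qed.

(** * The action of the factors on normal forms *)

Definition act b g (x : nform) : nform :=
  join_nf b (g ** fst (split_nf b x), snd (split_nf b x)).

Lemma act_split_ok b g (x : nform) : P b g -> valid x ->
  split_ok b (g ** fst (split_nf b x), snd (split_nf b x)).
Proof.
  intros pg vx; destruct (split_nf_ok b x vx) as (p&n&t).
  repeat split; auto; now apply subM.
Qed.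

Lemma act_valid b g (x : nform) : P b g -> valid x -> valid (act b g x).
Proof. intros; now apply join_nf_valid, act_split_ok. Qed.

Lemma act_mul b g g' (x : nform) : P b g -> P b g' -> valid x ->
  act b (g ** g') x = act b g (act b g' x).
Proof.
  intros pg pg' vx; unfold act at 2 3.
  rewrite join_nfK by now apply act_split_ok.
  simpl; now rewrite gmulA.
Qed.

Lemma act_one b (x : nform) : valid x -> act b gone x = x.
Proof.
  intros vx; unfold act; rewrite gmul1l, <- surjective_pairing; now apply split_nfK.
Qed.

(** The right-hand side is independent of [b]: the two factors act alike on [H], as the universal
    property requires. *)
Lemma act_H b h (x : nform) : H h -> valid x -> act b h x = (h ** fst x, snd x).
Proof.
  intros hh vx; pose proof vx as [hx _].
  assert (v' : valid (h ** fst x, snd x)) by (split; [simpl; sub|apply vx]).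
  rewrite <- (split_nfK b _ v'); unfold act; f_equal.
  destruct x as [k [|[c t] r]]; unfold split_nf; simpl; auto.
  destruct (eqb b c); simpl; f_equal; grp_eq.
Qed.

Lemma act_letter b a (x : nform) : letter b a -> valid x -> not_start b (snd x) ->
  exists h t, act b a x = (h, (b, t) :: snd x).
Proof.
  intros [pa na] [hx ok] ns; unfold act.
  assert (e : split_nf b x = x).
  { destruct x as [k [|[c t] r]]; unfold split_nf; simpl in *; auto.
    subst c; now destruct b. }
  rewrite e; unfold join_nf; simpl.
  destruct excluded_middle_informative as [hg|ng]; [|eauto].
  now rewrite subMr in hg.
Qed.

(* Extended by the identity outside [P b] and on invalid encodings, so as to be
   a permutation of the whole type. *)
Definition tact b g (x : nform) : nform :=
  if excluded_middle_informative (P b g /\ valid x) then act b g x else x.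

Lemma tact_act b g (x : nform) : P b g -> valid x -> tact b g x = act b g x.
Proof.
  intros; unfold tact; destruct excluded_middle_informative; tauto.
Qed.

Lemma tact_junk b g (x : nform) : ~ (P b g /\ valid x) -> tact b g x = x.
Proof.
  intros; unfold tact; destruct excluded_middle_informative; tauto.
Qed.

Lemma tact_mul b g g' (x : nform) : P b g -> P b g' ->
  tact b (g ** g') x = tact b g (tact b g' x).
Proof.
  intros pg pg'; destruct (classic (valid x)) as [vx|nv].
  - rewrite (tact_act b g' x), (tact_act b g), tact_act; sub;
      auto using act_mul, act_valid.
  - rewrite (tact_junk b g' x), !tact_junk; tauto.
Qed.

(** Also needed for [g] outside [P b], because [tact_perm b] has to be a total map on [G]; there [g]
    and its inverse both act as the identity. *)
Lemma tactV b g (x : nform) : tact b g^-1 (tact b g x) = x.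
Proof.
  destruct (classic (P b g)) as [pg|npg].
  - rewrite <- tact_mul, gmulVl by sub.
    destruct (classic (valid x)) as [vx|nv].
    + rewrite tact_act; sub; now apply act_one.
    + rewrite tact_junk; tauto.
  - rewrite !tact_junk; rewrite ?subV_iff; auto; tauto.
Qed.

Lemma tactVr b g (x : nform) : tact b g (tact b g^-1 x) = x.
Proof. rewrite <- (invgK g) at 1; apply tactV. Qed.

Definition tact_perm b g : perm_grp nform := Perm _ (tact b g) (tact b g^-1)
  (tactV b g) (tactVr b g).

Context (amalg : is_amalgam (P false) (P true) H).

(** Acting on the empty normal form [o], each letter of a reduced word adds a syllable, whereas an
    element of [H] leaves the list empty. *)
Theorem red_notin b c n x : red b c n x -> ~ H x.
Proof.
  destruct (amalg (perm_grp nform) (tact_perm false) (tact_perm true))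
    as [(f&hf&ff&ft) _].
  - intros g g' hg hg'; apply perm_eq; intros z; simpl; apply tact_mul; assumption.
  - intros g g' hg hg'; apply perm_eq; intros z; simpl; apply tact_mul; assumption.
  - intros h hh; apply perm_eq; intros z; simpl.
    destruct (classic (valid z)) as [vz|nz].
    + rewrite !tact_act, !act_H; auto.
    + rewrite !tact_junk; tauto.
  - assert (fP : forall d g, P d g -> f g = tact_perm d g) by (intros []; auto).
    set (o := (gone, []) : nform).
    assert (vo : valid o) by (split; simpl; [sub|exact I]).
    (* Recording the type of the leading syllable lets the next letter, of the other type, be added
       without merging. *)
    assert (key : red b c n x ->
              valid (fwd _ (f x) o) /\
              exists h t w, fwd _ (f x) o = (h, (b, t) :: w)).
    { induction 1 as [b a [pa na]|b c n a x [pa na] rx [v (h&t&w&e)]].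
      - rewrite (fP b a pa); simpl; rewrite tact_act by assumption.
        split; [now apply act_valid|].
        destruct (act_letter b a o) as (h&t&e); [split; auto| |exact I|]; eauto.
      - assert (E : fwd _ (f (a ** x)) o = act b a (fwd _ (f x) o)).
        { rewrite hf, (fP b a pa); now apply tact_act. }
        rewrite E.
        split; [now apply act_valid|].
        destruct (act_letter b a (fwd _ (f x) o)) as (h'&t'&e'); [now split|exact v|now rewrite e|].
        do 3 eexists; exact e'. }
    intros r hx; destruct (key r) as (_&h&t&w&e).
    rewrite (fP true x) in e by auto; simpl in e.
    rewrite tact_act, act_H in e; auto; discriminate.
Qed.

(** * Generation by the factors and existence of reduced forms *)

Inductive gen : G -> Prop :=
| gen_letter b a : P b a -> gen a
| gen_mul x y : gen x -> gen y -> gen (x ** y)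
| gen_inv x : gen x -> gen x^-1.

Lemma gen_subgroup : subgroup gen.
Proof.
  repeat split; auto using gen_mul, gen_inv.
  apply (gen_letter true); sub.
Qed.

(** The inclusions of the factors into [gen] extend to a homomorphism from [G] to [gen]. Followed by
    the inclusion into [G], it agrees with the identity on both factors, so by uniqueness it is the
    identity. *)
Lemma gen_all x : gen x.
Proof.
  set (L := sub_grp gen gen_subgroup).
  set (i := fun g => match excluded_middle_informative (gen g) with
                     | left p => exist gen g p : L | right _ => gone end).
  assert (iE : forall g, gen g -> proj1_sig (i g) = g).
  { intros g hg; unfold i; now destruct excluded_middle_informative. }
  assert (iM : forall b, ghom_on (P b) i).
  { intros b g g' hg hg'; apply sig_val_inj; simpl.
    rewrite !iE; eauto using gen_letter, gen_mul. }
  destruct (amalg L i i) as [(f&hf&ff&ft) _]; auto.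
  destruct (amalg G (fun g => g) (fun g => g)) as [_ uniq];
    try (intros ? ?; auto; fail).
  rewrite <- (uniq (fun g => proj1_sig (f g)) (fun g => g)).
  - apply proj2_sig.
  - intros g g'; now rewrite hf.
  - intros ? ?; reflexivity.
  - intros g hg; rewrite ff by assumption; apply iE; eauto using gen_letter.
  - intros g hg; rewrite ft by assumption; apply iE; eauto using gen_letter.
Qed.

(** A factor element is absorbed if it lies in [H], merges with a first letter of its own type, or
    becomes a new first letter. *)
Lemma red_mulP b g x : P b g -> H x \/ (exists d c n, red d c n x) ->
  H (g ** x) \/ (exists d c n, red d c n (g ** x)).
Proof.
  intros pg hx; destruct (classic (H g)) as [hg|ng].
  { destruct hx as [hx|(d&c&n&r)]; [left; sub|].
    right; exists d, c, n; now apply red_mulHl. }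
  destruct hx as [hx|(d&c&n&r)].
  { right; exists b, b, 1; apply red_mulHr; [|constructor; split]; auto. }
  destruct (bool_dec d b) as [->|ne].
  - assert (sub : forall a, P b a -> P b (g ** a)) by (intros; sub).
    destruct (red_uncons _ _ _ _ r) as [(_&_&[px _])|(m&a&y&->&[pa _]&ry&->)].
    + destruct (classic (H (g ** x))); [now left|].
      right; exists b, b, 1; constructor; split; auto.
    + rewrite <- mulgA; destruct (classic (H (g ** a))) as [hga|nga].
      * right; exists (negb b), c, m; now apply red_mulHl.
      * right; exists b, c, (S m); constructor; [split|]; auto.
  - right; exists b, c, (S n); constructor; [split; auto|].
    now replace (negb b) with d by now destruct b, d.
Qed.

Theorem red_exists x : H x \/ exists b c n, red b c n x.
Proof.
  (* Treating [x] and its inverse together makes the inversion case of [gen] immediate. *)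
  assert (K : forall x, gen x -> forall y, let Q z := H z \/ exists b c n, red b c n z in
    Q y -> Q (x ** y) /\ Q (x^-1 ** y)).
  { clear x; induction 1 as [b a pa|x z _ IHx _ IHz|x _ IHx]; intros y Q hy.
    - split; apply (red_mulP b); sub.
    - rewrite invMg, !mulgA; split; [apply IHx, IHz, hy|apply IHz, IHx, hy].
    - rewrite invgK; split; apply IHx, hy. }
  rewrite <- (gmul1r _ x); apply (K x (gen_all x)); left; sub.
Qed.

End NormalForm.

(** * Conjugating finite sets into one side of an edge *)

Section Conjugation.
Context (red_nH : forall b c n x, red b c n x -> ~ H x).
Context (red_ex : forall x, H x \/ exists b c n, red b c n x).

Definition starts b x : Prop := exists c n, red b c n x.

(** Otherwise [x^-1 ** x] would be a reduced word with value in [H]. *)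
Lemma starts_neq b c x y : starts b x -> starts c y -> b <> c -> x <> y.
Proof.
  intros (d&n&r) (e&m&r') ne <-.
  apply (red_nH d e (n + m) (x^-1 ** x)); [|grp; sub].
  apply red_cat with b; [now apply red_inv|].
  now replace (negb b) with c by now destruct b, c.
Qed.

(* [x] moves the edge [H] of the Bass-Serre tree to an edge on its side [i], and so
   does [x^-1]; hence the fixed points of [x], if any, all lie on that side. *)
Definition one_sided i x : Prop := exists n, red i i n x.

Lemma one_sided_nH i x : one_sided i x -> ~ H x.
Proof. intros [n r]; eauto. Qed.

Lemma one_sided_inv i x : one_sided i x -> one_sided i x^-1.
Proof. intros [n r]; exists n; now apply red_inv. Qed.

Lemma one_sided_conj i c n x u : one_sided i x -> red (negb i) c n u ->
  one_sided c (u^-1 ** x ** u).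
Proof.
  intros [m r] ru; exists (n + m + n).
  apply red_cat with i; [apply red_cat with (negb i)|]; auto using red_inv.
  now rewrite negb_involutive.
Qed.

(** The ping-pong inclusion: if [y] is reduced of the other starting type, nothing cancels; if [y]
    is in [H], the last letter of [x] absorbs it. *)
Lemma one_sided_mul i x y : one_sided i x -> ~ starts i y -> starts i (x ** y).
Proof.
  intros [m r] ns; destruct (red_ex y) as [hy|(b&c&n&ry)].
  - exists i, m; now apply red_mulHr.
  - exists c, (m + n); apply red_cat with i; auto.
    replace (negb i) with b; auto.
    destruct (bool_dec b i) as [->|ne]; [|now destruct b, i].
    now exfalso; apply ns; exists c, n.
Qed.

(** The form in which index at least 3 is used: [a'] represents a coset [a' H] other than [H] and
    [a H]. *)
Definition large b : Prop :=
  forall a, letter b a -> exists a', letter b a' /\ letter b (a'^-1 ** a).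

Lemma large_pair b : (exists a, letter b a) -> large b ->
  exists a a', letter b a /\ letter b a' /\ letter b (a'^-1 ** a).
Proof. intros [a la] lb; destruct (lb a la) as (a'&?&?); eauto. Qed.

Context (ex_letter : forall b, exists a, letter b a).
Context (ex_large : forall b, large b \/ large (negb b)).
Context (K_trivial : forall b x, H x -> x <> gone ->
  exists c n u, red b c n u /\ ~ H (u^-1 ** x ** u)).

Lemma large_red b c n x : large b -> red b c n x ->
  exists a, letter b a /\ red b c n (a^-1 ** x).
Proof.
  intros lb r; destruct (red_uncons _ _ _ _ r) as [(->&->&lx)|(m&p&y&->&lp&ry&->)].
  - destruct (lb x lx) as (a&la&l); exists a; split; [|constructor]; assumption.
  - destruct (lb p lp) as (a&la&l); exists a; split; [assumption|].
    rewrite gmulA; now constructor.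
Qed.

(** The first letter of [u] that moves the conjugate out of [H] turns it into a single letter of its
    own type; the remaining letters wrap around it without cancellation. *)
Lemma one_sided_of_H b c n u x : red b c n u -> H x -> ~ H (u^-1 ** x ** u) ->
  one_sided c (u^-1 ** x ** u).
Proof.
  intros r; revert x; induction r as [b a [pa na]|b c n a u [pa na] r IH]; intros x hx nx.
  - exists 1; constructor; split; sub.
  - replace ((a ** u)^-1 ** x ** (a ** u)) with (u^-1 ** (a^-1 ** x ** a) ** u)
      in * by grp_eq.
    destruct (classic (H (a^-1 ** x ** a))) as [h|nh]; auto.
    apply one_sided_conj with b n; [|exact r].
    exists 1; constructor; split; sub.
Qed.

(** Prescribing the first type of [u] allows conjugators to be concatenated as reduced words. *)
Definition reach b x : Prop :=
  exists c n u, red b c n u /\ one_sided c (u^-1 ** x ** u).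

Lemma reachV b x : reach b x^-1 -> reach b x.
Proof.
  intros (c&n&u&r&o); exists c, n, u; split; [exact r|].
  apply one_sided_inv in o.
  now replace (u^-1 ** x ** u) with (u^-1 ** x^-1 ** u)^-1 by grp_eq.
Qed.

Lemma reach_cons b a x : letter b a -> reach (negb b) (a^-1 ** x ** a) -> reach b x.
Proof.
  intros la (c&n&u&r&o); exists c, (S n), (a ** u); split; [now constructor|].
  now replace ((a ** u)^-1 ** x ** (a ** u)) with (u^-1 ** (a^-1 ** x ** a) ** u)
    by grp_eq.
Qed.

Lemma reach_letter b a x : letter b a -> one_sided b (a^-1 ** x ** a) -> reach b x.
Proof. intros; exists b, 1, a; split; [now constructor|assumption]. Qed.

Lemma reach_H b x : H x -> x <> gone -> reach b x.
Proof.
  intros hx nx; destruct (K_trivial b x hx nx) as (c&n&u&r&nh).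
  exists c, n, u; split; [exact r|]; eauto using one_sided_of_H.
Qed.

Lemma reach_one_sided b x : one_sided (negb b) x -> reach b x.
Proof.
  intros o; destruct (ex_letter b) as [a la]; apply (reach_letter b a); [exact la|].
  apply one_sided_conj with (negb b) 1; [exact o|].
  rewrite negb_involutive; now constructor.
Qed.

Lemma reach_even b n x : red b (negb b) n x -> reach b x.
Proof.
  intros r; destruct (ex_large b) as [lb|lb].
  - destruct (large_red _ _ _ _ lb r) as (a&la&ra); apply (reach_letter b a _ la).
    exists (n + 1); apply red_cat with (negb b); [exact ra|].
    rewrite negb_involutive; now constructor.
  (* Only the other factor is large here, so the conjugator is [p ** a], with [p] the first letter
     of [x] and [a] chosen so that [a^-1 ** y] keeps its type. *)
  - destruct (red_uncons _ _ _ _ r) as [(_&e&_)|(m&p&y&->&lp&ry&->)].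
    { now destruct b. }
    destruct (large_red _ _ _ _ lb ry) as (a&la&ra).
    apply (reach_cons b p); [exact lp|]; apply (reach_letter _ a _ la).
    exists (m + (1 + 1)).
    replace (a^-1 ** (p^-1 ** (p ** y) ** p) ** a) with ((a^-1 ** y) ** (p ** a)) by grp_eq.
    apply red_cat with (negb b); [exact ra|]; rewrite negb_involutive.
    apply red_cons; [exact lp|now constructor].
Qed.

Lemma reach_even_r b n x : red (negb b) b n x -> reach b x.
Proof. intros r; apply reachV, reach_even with n; now apply red_inv. Qed.

Lemma reach_odd b n x : red b b n x -> reach b x.
Proof.
  revert b x; induction n as [n IH] using lt_wf_ind; intros b x r.
  destruct (red_uncons _ _ _ _ r) as [(->&_&lx)|(m&p&y&->&lp&ry&->)].
  { apply (reach_letter b x x lx); exists 1; constructor.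
    now rewrite gmulVl, gmul1l. }
  apply (reach_cons b p _ lp).
  replace (p^-1 ** (p ** y) ** p) with (y ** p) by grp_eq.
  destruct (red_unsnoc _ _ _ _ ry) as [(_&e&_)|(k&q&z&->&lq&rz&->)].
  { now destruct b. }
  (* Conjugation by [p] has brought the last letter [q] next to [p]. If [q ** p] is in [H], the word
     shortens by two; otherwise it is one letter and the word has even length. *)
  rewrite mulgA; destruct (classic (H (q ** p))) as [h|nh].
  - apply (IH k); [lia|]; now apply red_mulHr.
  - apply reach_even with (k + 1); rewrite negb_involutive.
    apply red_cat with (negb b); [exact rz|].
    rewrite negb_involutive; constructor; split; [|exact nh].
    destruct lp, lq; sub.
Qed.

Lemma reach_all b x : x <> gone -> reach b x.
Proof.
  intros nx; destruct (red_ex x) as [hx|(c&d&n&r)]; [now apply reach_H|].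
  destruct (bool_dec c b) as [->|nc], (bool_dec d b) as [->|nd].
  - now apply reach_odd with n.
  - apply reach_even with n; now replace (negb b) with d by now destruct b, d.
  - apply reach_even_r with n; now replace (negb b) with c by now destruct b, c.
  - apply reach_one_sided; exists n.
    now replace c with (negb b) in r by (now destruct b, c);
    replace d with (negb b) in r by now destruct b, d.
Qed.

Lemma one_sided_list (F : list G) : (forall f, In f F -> f <> gone) ->
  exists b c n u, red b c n u /\ forall f, In f F -> one_sided c (u^-1 ** f ** u).
Proof.
  induction F as [|f F IH]; intros nF.
  - destruct (ex_letter true) as [a la]; exists true, true, 1, a.
    split; [now constructor|intros _ []].
  - destruct IH as (b&c&n&u&ru&oF); [intros; apply nF; now right|].
    (* Since [v] starts with the type opposite to [c], [u ** v] is reduced and the elements already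
       treated stay one-sided. *)
    destruct (reach_all (negb c) (u^-1 ** f ** u)) as (d&m&v&rv&o).
    { apply conjg_neq1, nF; now left. }
    exists b, d, (n + m), (u ** v); split; [now apply red_cat with c|].
    intros k hk.
    replace ((u ** v)^-1 ** k ** (u ** v)) with (v^-1 ** (u^-1 ** k ** u) ** v) by grp_eq.
    destruct hk as [<-|hk]; [exact o|]; eauto using one_sided_conj.
Qed.

Theorem one_sided_conj_list i (F : list G) : (forall f, In f F -> f <> gone) ->
  exists u, forall f, In f F -> one_sided i (u^-1 ** f ** u).
Proof.
  intros nF; destruct (one_sided_list F nF) as (b&c&n&u&_&o).
  destruct (bool_dec c i) as [->|nc]; [now exists u|].
  destruct (ex_letter i) as [a la]; exists (u ** a); intros f hf.
  replace ((u ** a)^-1 ** f ** (u ** a)) with (a^-1 ** (u^-1 ** f ** u) ** a) by grp_eq.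
  apply one_sided_conj with c 1; [now apply o|].
  replace (negb c) with i by (now destruct c, i); now constructor.
Qed.

(** * Ping-pong *)

Lemma ex_large_factor : exists j, large j.
Proof. destruct (ex_large true); eauto. Qed.

(* By [one_sided_mul], the elements [(a c)^m b] have pairwise disjoint translates
   of the set of elements starting with the type of [c]. *)
Lemma power_pingpong j (a b c : G) : letter j a -> letter j b -> letter (negb j) c ->
  letter j (b^-1 ** a) ->
  forall m n, m < n -> one_sided j
    ((Nat.iter m (gmul (a ** c)) b)^-1 ** Nat.iter n (gmul (a ** c)) b).
Proof.
  intros la lb lc lba m n lt.
  assert (K : forall k, one_sided j (Nat.iter k (gmul (a ** c)) b)).
  { induction k as [|k [p r]]; simpl.
    - exists 1; now constructor.
    - exists (S (S p)); rewrite mulgA; constructor; [exact la|].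
      constructor; [exact lc|]; now rewrite negb_involutive. }
  induction m as [|m IH] in n, lt |- *; (destruct n as [|n]; [lia|]); simpl.
  - destruct (K n) as [p r]; exists (S (S p)).
    rewrite <- !mulgA, (mulgA _ c); constructor; [exact lba|].
    constructor; [exact lc|]; now rewrite negb_involutive.
  - rewrite invMg, mulgA, mulKg; apply IH; lia.
Qed.

Theorem powers : powers_group G.
Proof.
  intros F k nF _; destruct ex_large_factor as [j lj].
  destruct (one_sided_conj_list (negb j) F nF) as [u oF].
  destruct (large_pair j (ex_letter j) lj) as (a&b&la&lb&lba).
  destruct (ex_letter (negb j)) as [c lc].
  exists (fun x => ~ starts (negb j) (u^-1 ** x)).
  exists (fun m => Nat.iter m (gmul (a ** c)) b ** u^-1); split.
  - intros f hf x dx d; apply d.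
    replace (u^-1 ** (f ** x)) with ((u^-1 ** f ** u) ** (u^-1 ** x)) by grp_eq.
    apply one_sided_mul; auto.
  - assert (K : forall m n x y, m < n ->
      ~ ~ starts (negb j) (u^-1 ** x) -> ~ ~ starts (negb j) (u^-1 ** y) ->
      Nat.iter m (gmul (a ** c)) b ** u^-1 ** x <>
      Nat.iter n (gmul (a ** c)) b ** u^-1 ** y).
    { intros m n x y lt dx dy; apply NNPP in dx, dy; rewrite !mulgA; intros e.
      (* Solving [e] for [u^-1 ** x] exhibits it as a one-sided element of type [j] times
         [u^-1 ** y], so it would start with both types. *)
      pose proof (power_pingpong j a b c la lb lc lba m n lt) as o.
      apply (one_sided_mul j _ (u^-1 ** y)) in o.
      - rewrite mulgA, <- e, mulKg in o.
        apply (starts_neq _ _ _ _ o dx); [now destruct j|reflexivity].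
      - intros s; apply (starts_neq _ _ _ _ s dy); [now destruct j|reflexivity]. }
    intros m n _ _ ne x y dx dy.
    destruct (proj1 (Nat.lt_gt_cases m n) ne) as [lt|gt]; [now apply K|].
    intros e; symmetry in e; revert e; now apply K.
Qed.

(** Both products are applied to [o]. As no image of [A] contains [o], the empty word is told apart
    from the others; disjointness of the images identifies the first letters, which then cancel. *)
Lemma free_of_pingpong (F : list G) (g o : G) (A : G -> Prop) : A o ->
  (forall f x, In f F -> A x -> A (g ** f ** x)) ->
  (forall f x, In f F -> A x -> g ** f ** x <> o) ->
  (forall f f' x y, In f F -> In f' F -> A x -> A y ->
     g ** f ** x = g ** f' ** y -> f = f') ->
  forall s t : list G,
    (forall a, In a s -> exists f, In f F /\ a = g ** f) ->
    (forall a, In a t -> exists f, In f F /\ a = g ** f) ->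
    gprod s = gprod t -> s = t.
Proof.
  intros Ao Ag Ago Adisj.
  assert (K : forall s, (forall a, In a s -> exists f, In f F /\ a = g ** f) ->
            A (gprod s ** o)).
  { induction s as [|a s IH]; intros hs; simpl.
    - now rewrite gmul1l.
    - destruct (hs a (or_introl eq_refl)) as (f&hf&->).
      rewrite mulgA; apply Ag; auto; apply IH; intros; apply hs; now right. }
  induction s as [|a s IH]; intros [|a' t] hs ht e; auto; simpl in e.
  - exfalso; destruct (ht a' (or_introl eq_refl)) as (f&hf&->).
    apply (Ago f (gprod t ** o) hf).
    + apply K; intros; apply ht; now right.
    + rewrite gmulA, <- e; apply gmul1l.
  - exfalso; destruct (hs a (or_introl eq_refl)) as (f&hf&->).
    apply (Ago f (gprod s ** o) hf).
    + apply K; intros; apply hs; now right.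
    + rewrite gmulA, e; apply gmul1l.
  - destruct (hs a (or_introl eq_refl)) as (f&hf&->).
    destruct (ht a' (or_introl eq_refl)) as (f'&hf'&->).
    assert (f = f') as <-.
    { apply (Adisj f f' (gprod s ** o) (gprod t ** o)); auto.
      - apply K; intros; apply hs; now right.
      - apply K; intros; apply ht; now right.
      - now rewrite !(gmulA _ (g ** _)), e. }
    apply mulgI in e; f_equal; apply IH; auto; intros; [apply hs|apply ht]; now right.
Qed.

Theorem free_semigroup : free_semigroup_property G.
Proof.
  intros F; destruct ex_large_factor as [j lj].
  (* Adding [gone] to [F] makes the elements of [F] themselves differences. *)
  set (F1 := gone :: F).
  set (dF := filter (fun z => if excluded_middle_informative (z = gone) then false else true)
               (map (fun p => (fst p)^-1 ** snd p) (list_prod F1 F1))).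
  destruct (one_sided_conj_list (negb j) dF) as [c oF].
  { intros z hz; apply filter_In in hz as [_ hz].
    now destruct excluded_middle_informative. }
  assert (oD : forall f f', In f F1 -> In f' F1 -> f <> f' ->
            one_sided (negb j) (c^-1 ** (f^-1 ** f') ** c)).
  { intros f f' hf hf' ne; apply oF, filter_In; split.
    - apply in_map_iff; exists (f, f'); split; [reflexivity|]; now apply in_prod.
    - destruct excluded_middle_informative as [e|]; [|reflexivity].
      exfalso; apply ne; apply invg_uniq in e; rewrite invgK in e; now symmetry. }
  clear oF; destruct (large_pair j (ex_letter j) lj) as (b&b'&lb&lb'&lbb).
  destruct (ex_letter (negb j)) as [a la].
  assert (lj1 : forall l x, letter j l -> starts (negb j) x -> starts j (l ** x)).
  { intros l x ll (d&n&r); exists d, (S n); now constructor. }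
  (* For [f = gone] the two outer letters merge into the letter [b'^-1 ** b]; otherwise the
     one-sided conjugate of [f] separates them. *)
  assert (key : forall f x, In f F1 -> starts (negb j) x ->
            starts j (b'^-1 ** (c^-1 ** f ** c) ** b ** x)).
  { intros f x hf sx; destruct (classic (f = gone)) as [->|nf].
    - replace (b'^-1 ** (c^-1 ** gone ** c) ** b ** x) with ((b'^-1 ** b) ** x) by grp_eq.
      now apply lj1.
    - specialize (oD gone f (or_introl eq_refl) hf (not_eq_sym nf)).
      rewrite invg1, gmul1l in oD; rewrite !mulgA; apply lj1; [now apply letterV|].
      replace (c^-1 ** (f ** (c ** (b ** x)))) with ((c^-1 ** f ** c) ** (b ** x)) by grp_eq.
      apply one_sided_mul; [exact oD|].
      intros s; apply (starts_neq _ _ _ _ s (lj1 b x lb sx)); [now destruct j|reflexivity]. }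
  set (A := fun z => starts (negb j) (b^-1 ** c^-1 ** z)).
  exists (c ** b ** a ** b'^-1 ** c^-1); intros s t _ _ hs ht.
  assert (gE : forall f z, c ** b ** a ** b'^-1 ** c^-1 ** f ** z =
     c ** b ** a ** (b'^-1 ** (c^-1 ** f ** c) ** b ** (b^-1 ** c^-1 ** z)))
    by (intros; grp_eq).
  apply (free_of_pingpong F1 (c ** b ** a ** b'^-1 ** c^-1) (c ** b ** a) A).
  - unfold A; grp; exists (negb j), 1; now constructor.
  - intros f z hf Az; rewrite gE; unfold A; rewrite !mulgA, !mulKg.
    destruct (key f _ hf Az) as (d&n&r); exists d, (S n); rewrite !mulgA in r.
    constructor; [exact la|]; now rewrite negb_involutive.
  - intros f z hf Az e; rewrite gE in e.
    rewrite <- (gmul1r _ (c ** b ** a)) in e at 2; apply mulgI in e.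
    destruct (key f _ hf Az) as (d&n&r); rewrite e in r; apply (red_nH _ _ _ _ r); sub.
  (* From [f ** x = f' ** y], the one-sided conjugate of [f^-1 ** f'] would send an element starting
     with type [j] to another such element, whereas its image starts with type [negb j]. *)
  - intros f f' x y hf hf' Ax Ay e; apply NNPP; intros ne.
    rewrite !(mulgA _ f), !(mulgA _ f') in e.
    pose proof (oD f f' hf hf' ne) as o.
    assert (e' : f ** x = f' ** y).
    { apply (mulgI (c ** b ** a ** b'^-1 ** c^-1)); rewrite !gmulA in *; exact e. }
    apply (one_sided_mul _ _ (b ** (b^-1 ** c^-1 ** y))) in o.
    + replace (c^-1 ** (f^-1 ** f') ** c ** (b ** (b^-1 ** c^-1 ** y)))
        with (b ** (b^-1 ** c^-1 ** x)) in o.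
      * apply (starts_neq _ _ _ _ o (lj1 b _ lb Ax)); [now destruct j|reflexivity].
      * grp; now rewrite <- e', mulKg.
    + intros s'; apply (starts_neq _ _ _ _ s' (lj1 b _ lb Ay)); [now destruct j|reflexivity].
  - intros z hz; destruct (hs z hz) as (f&hf&->); exists f; split; [now right|reflexivity].
  - intros z hz; destruct (ht z hz) as (f&hf&->); exists f; split; [now right|reflexivity].
Qed.

End Conjugation.
End ReducedWords.

(** * Translation to the sets [Tset] and indices *)

Section Amalgam.
Context {G : grp} (G0 G1 H : G -> Prop).
Implicit Types (a x g : G) (j k : nat).

Definition factor (b : bool) : G -> Prop := if b then G1 else G0.

Lemma Gsel_factor j : Gsel G0 G1 j = factor (Nat.odd j).
Proof. unfold Gsel; rewrite <- Nat.negb_odd; now destruct (Nat.odd j). Qed.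

Lemma odd_S j : Nat.odd (S j) = negb (Nat.odd j).
Proof. now rewrite Nat.odd_succ, <- Nat.negb_odd. Qed.

Lemma alt_word_red j (l : list G) : l <> [] -> alt_word G0 G1 H j l ->
  exists c, red factor H (Nat.odd j) c (length l) (gprod l).
Proof.
  revert j; induction l as [|a [|a' l] IH]; intros j nl w; [easy| |];
    destruct w as (pa&na&w); rewrite Gsel_factor in pa.
  - simpl; rewrite gmul1r; exists (Nat.odd j); constructor; now split.
  - destruct (IH (S j)) as [c r]; [discriminate|exact w|]; rewrite odd_S in r.
    exists c; constructor; [now split|exact r].
Qed.

Lemma red_alt_word b c n x : red factor H b c n x -> forall j, Nat.odd j = b ->
  exists l, length l = n /\ alt_word G0 G1 H j l /\ x = gprod l.
Proof.
  induction 1 as [b a [pa na]|b c n a x [pa na] r IH]; intros j e.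
  - exists [a]; simpl; rewrite Gsel_factor, e, gmul1r; auto.
  - destruct (IH (S j)) as (l&<-&w&->); [now rewrite odd_S, e|].
    exists (a :: l); simpl; rewrite Gsel_factor, e; auto.
Qed.

Lemma red_Tset c n x j : red factor H (Nat.odd j) c n x -> Tset G0 G1 H j n x.
Proof.
  intros r; destruct (red_alt_word _ _ _ _ r j eq_refl) as (l&el&w&e).
  destruct n; [inversion r|]; now exists l.
Qed.

Lemma Tset_red j k x : Tset G0 G1 H j (S k) x ->
  exists c n, red factor H (Nat.odd j) c n x.
Proof.
  intros (l&el&w&->); destruct (alt_word_red j l) as [c r]; eauto.
  now intros ->.
Qed.

Context (sH : subgroup H).

Lemma index2_letter b : index_ge (factor b) H 2 -> exists a, letter factor H b a.
Proof.
  intros ([|x [|y [|]]]&[=]&hl&nl); specialize (nl 0 1 ltac:(lia) ltac:(lia) ltac:(lia)).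
  simpl in *; destruct (classic (H x)) as [hx|nx].
  - exists y; split; [auto|]; intros hy; apply nl; sub.
  - exists x; split; auto.
Qed.

Lemma index_ge_3_2 (A : G -> Prop) : index_ge A H 3 -> index_ge A H 2.
Proof.
  intros ([|x [|y [|z [|]]]]&[=]&hl&nl); exists [x; y]; split; [easy|split].
  - intros w [<-|[<-|[]]]; apply hl; simpl; auto.
  - intros [|[|i]] [|[|j]] hi hj ne; try lia.
    + apply (nl 0 1); lia.
    + apply (nl 1 0); lia.
Qed.

(** Of three representatives of distinct cosets, at most one lies in [H] and at most one in [a H]; a
    remaining one serves as [a']. *)
Lemma index3_large b : (forall c, subgroup (factor c)) ->
  index_ge (factor b) H 3 -> large factor H b.
Proof.
  intros sP ([|x [|y [|z [|]]]]&[=]&hl&nl) a [pa na].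
  assert (K : forall u, factor b u ->
     (exists a', letter factor H b a' /\ letter factor H b (a'^-1 ** a)) \/
     H u \/ H (u^-1 ** a)).
  { intros u pu; destruct (classic (H u)); auto; destruct (classic (H (u^-1 ** a))); auto.
    left; exists u; repeat split; auto; sub. }
  assert (HH : forall u v, H u -> H v -> H (u^-1 ** v)) by (intros; sub).
  assert (Ha : forall u v, H (u^-1 ** a) -> H (v^-1 ** a) -> H (u^-1 ** v)).
  { intros u v hu hv.
    replace (u^-1 ** v) with ((u^-1 ** a) ** (v^-1 ** a)^-1) by grp_eq; sub. }
  pose proof (nl 0 1 ltac:(lia) ltac:(lia) ltac:(lia)) as n01.
  pose proof (nl 0 2 ltac:(lia) ltac:(lia) ltac:(lia)) as n02.
  pose proof (nl 1 2 ltac:(lia) ltac:(lia) ltac:(lia)) as n12.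
  simpl in *.
  destruct (K x) as [|[]], (K y) as [|[]], (K z) as [|[]]; auto; exfalso; auto.
Qed.

End Amalgam.

Theorem theorem3p2 (G : grp) (G0 G1 H : G -> Prop)
  (hG0 : subgroup G0) (hG1 : subgroup G1) (hH : subgroup H)
  (hHG0 : forall h, H h -> G0 h) (hHG1 : forall h, H h -> G1 h)
  (hamalg : is_amalgam G0 G1 H) (hnd : nondegenerate G0 G1 H) :
  let cond_i := (forall x, Kset G0 G1 H 0 x <-> x = gone) /\
                (forall x, Kset G0 G1 H 1 x <-> x = gone) in
  let cond_ii := forall F : list G, (forall f, In f F -> f <> gone) ->
                   exists g : G, forall f, In f F -> ~ H (gmul (gmul g f) (ginv g)) in
  let cond_iii := forall F : list G, (forall f, In f F -> H f /\ f <> gone) ->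
                   exists g : G, forall f, In f F -> ~ H (gmul (gmul g f) (ginv g)) in
  (cond_i <-> cond_ii) /\ (cond_i <-> cond_iii) /\
  (cond_i -> powers_group G /\ free_semigroup_property G).
Proof.
  intros ci cii ciii.
  set (P := factor G0 G1).
  assert (sP : forall b, subgroup (P b)) by (intros []; assumption).
  assert (HP : forall b h, H h -> P b h) by (intros []; assumption).
  pose proof (red_notin P H sP hH HP hamalg) as red_nH.
  pose proof (red_exists P H sP hH HP hamalg) as red_ex.
  assert (ex_letter : forall b, exists a, letter P H b a).
  { intros b; apply index2_letter; auto.
    destruct hnd as [[i0 i1]|[i0 i1]], b; auto using index_ge_3_2. }
  assert (ex_large : forall b, large P H b \/ large P H (negb b)).
  { destruct hnd as [[_ i]|[i _]];
      [assert (large P H true) by (apply index3_large; auto)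
      |assert (large P H false) by (apply index3_large; auto)]; intros []; auto. }
  assert (K_trivial : ci -> forall b x, H x -> x <> gone ->
    exists c n u, red P H b c n u /\ ~ H (u^-1 ** x ** u)).
  { intros [k0 k1] b x hx nx.
    assert (e : Nat.odd (Nat.b2n b) = b) by now destruct b.
    assert (nK : ~ Kset G0 G1 H (Nat.b2n b) x)
      by (destruct b; intros h; apply nx; [now apply k1|now apply k0]).
    apply not_all_ex_not in nK as [k nK]; apply not_all_ex_not in nK as [g nK].
    apply imply_to_and in nK as [t nh].
    (* For [k = 0] the element [g] is in [H], and conjugation by it cannot take [x] out of [H]. *)
    destruct k as [|k]; [exfalso; apply nh; simpl in t; sub|].
    apply Tset_red in t as (c&n&r); rewrite e in r; now exists c, n, g. }
  assert (i_ii : ci -> cii).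
  { intros i F nF.
    destruct (one_sided_conj_list P H sP hH HP red_ex ex_letter ex_large
      (K_trivial i) true F nF) as [u hu].
    exists u^-1; intros f hf; rewrite invgK; eauto using one_sided_nH. }
  assert (ii_iii : cii -> ciii) by (intros ii F hF; apply ii; firstorder).
  assert (iii_i : ciii -> ci).
  { intros iii.
    assert (K : forall j x, Kset G0 G1 H j x <-> x = gone).
    { intros j x; split.
      - intros kx; apply NNPP; intros nx.
        assert (hx : H x).
        { pose proof (kx 0 gone (sub1 H hH)) as h; autorewrite with grp in h; exact h. }
        destruct (ex_letter (Nat.odd j)) as [s ls].
        assert (hsx : H (s^-1 ** x ** s))
          by (apply (kx 1), (red_Tset _ _ _ (Nat.odd j)); now constructor).
        destruct (iii [x; s^-1 ** x ** s]) as [g hg].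
        { intros f [<-|[<-|[]]]; split; auto; now apply conjg_neq1. }
        assert (n1 : ~ H (g ** x ** g^-1)) by (apply hg; simpl; auto).
        assert (n2 : ~ H (g ** (s^-1 ** x ** s) ** g^-1)) by (apply hg; simpl; auto).
        (* If [g^-1] starts with the type of [j], then [x] being in [K_j] keeps its conjugate by [g]
           in [H]. If it starts with the other type, [s ** g^-1] starts with the type of [j], and
           the conjugate of [s^-1 ** x ** s] stays in [H]. *)
        destruct (red_ex g^-1) as [h|(b&c&n&r)].
        { apply n1; rewrite subV_iff in h by exact hH; sub. }
        destruct (bool_dec b (Nat.odd j)) as [->|ne].
        + apply red_Tset, kx in r; rewrite invgK in r; auto.
        + assert (r' : red P H (Nat.odd j) c (S n) (s ** g^-1)).
          { constructor; [exact ls|].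
            now replace (negb (Nat.odd j)) with b by now destruct b, (Nat.odd j). }
          apply red_Tset, kx in r'; apply n2.
          now replace (g ** (s^-1 ** x ** s) ** g^-1)
            with ((s ** g^-1)^-1 ** x ** (s ** g^-1)) by grp_eq.
      - intros -> k g t; autorewrite with grp; sub. }
    now split. }
  split; [|split]; try tauto.
  intros i; split.
  - exact (powers P H sP hH HP red_nH red_ex ex_letter ex_large (K_trivial i)).
  - exact (free_semigroup P H sP hH HP red_nH red_ex ex_letter ex_large (K_trivial i)).
Qed.
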